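(* Let $Y$ be a non-compact metrizable space, $X$ a $Y$-Tychonoff space, and let $H$ be a subspace of $B(X,Y)$ containing $B_1^{st}(X,Y)$. Then the following assertions are equivalent: (i) $H$ is a Fréchet–Urysohn space; (ii) $H$ is a sequential space; (iii) $H$ is a $k$-space; (iv) $H$ has countable tightness; (v) $X_{\aleph_0}$ satisfies the property $\gamma$.
   Context: $X$ is $Y$-Tychonoff if for every closed $A\subseteq X$, point $y_0\in Y$ and function $f:F\to Y$ on a finite set $F\subseteq X\setminus A$ there is a continuous $\bar f:X\to Y$ with $\bar f|_F=f$ and $\bar f(A)\subseteq\{y_0\}$. $B_0(X,Y)=C(X,Y)$ is the set of continuous functions; for a nonzero countable ordinal $\alpha$, $B_\alpha(X,Y)$ is the set of functions $X\to Y$ that are pointwise limits of sequences from $\bigcup_{\beta<\alpha}B_\beta(X,Y)$; $B(X,Y)=\bigcup_{\alpha<\omega_1}B_\alpha(X,Y)$. $B_1^{st}(X,Y)$ is the set of all $f:X\to Y$ for which there is a sequence $\{f_n\}$ in $C(X,Y)$ stably converging to $f$, i.e. for every $x\in X$ the set $\{n: f_n(x)\ne f(x)\}$ is finite. All these sets carry the topology of pointwise convergence inherited from $Y^X$. $X_{\aleph_0}$ is the set $X$ with the Baire topology, whose base is the family of all zero-sets $f^{-1}(0)$, $f:X\to\mathbb R$ continuous. A family $\gamma$ of subsets of a space $Z$ is an $\omega$-cover if every finite subset of $Z$ is contained in some member of $\gamma$. $Z$ has the property $\gamma$ if for every open $\omega$-cover there is a sequence $\{U_n\}_{n\in\omega}$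 of its members with $\bigcup_{n}\bigcap_{i\ge n}U_i=Z$. A space is Fréchet–Urysohn if whenever $a\in\overline A$ there is a sequence in $A$ converging to $a$; sequential if for each non-closed $A$ there is a sequence in $A$ converging to a point of $\overline A\setminus A$; a $k$-space if for each non-closed $A$ there is a compact $K$ such that $A\cap K$ is not closed in $K$; of countable tightness if whenever $a\in\overline A$ there is a countable $B\subseteq A$ with $a\in\overline B$. *)

(* Defs.v *)
From HB Require Import structures.
From mathcomp Require Import all_boot all_order all_algebra.
From mathcomp Require Import all_classical all_reals all_analysis.
From mathcomp Require wochoice.

Set Implicit Arguments.
Unset Strict Implicit.
Unset Printing Implicit Defensive.

Import Order.TTheory GRing.Theory Num.Theory.
Import numFieldNormedType.Exports.
Local Open Scope classical_set_scope.
Local Open Scope ring_scope.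

Definition is_metric (R : realType) (T : Type) (d : T -> T -> R) : Prop :=
  [/\ forall x y, 0 <= d x y,
      forall x y, d x y = 0 <-> x = y,
      forall x y, d x y = d y x &
      forall x y z, d x z <= d x y + d y z].

Definition metrizable (R : realType) (Y : topologicalType) : Prop :=
  exists2 d : Y -> Y -> R, is_metric d &
    forall (y : Y) (A : set Y),
      nbhs y A <-> exists2 e : R, 0 < e & [set z | d y z < e] `<=` A.

Definition Y_tychonoff (X Y : topologicalType) : Prop :=
  forall (A : set X) (y0 : Y) (F : set X) (f : F -> Y),
    closed A -> finite_set F -> F `<=` ~` A ->
    exists g : X -> Y,
      [/\ continuous g, forall x : F, g (\val x) = f x & g @` A `<=` [set y0]].

(* A countable ordinal alpha is presented as a position [a] in a well-ordering
   [r] of [nat], alpha being the order type of the strict predecessors of [a].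
   Every alpha < omega_1 arises in this way, and the class depends on [r] and
   [a] only through alpha; it is defined by recursion along [r]. *)
Inductive baire_class (X Y : topologicalType) (r : rel nat) :
    nat -> (X -> Y) -> Prop :=
  | baire_class_zero (a : nat) (f : X -> Y) :
      (forall b, r b a -> b = a) -> continuous f -> baire_class r a f
  | baire_class_lim (a : nat) (f : X -> Y) (u : nat -> X -> Y)
      (b : nat -> nat) :
      (forall n, r (b n) a /\ b n <> a) ->
      (forall n, baire_class r (b n) (u n)) ->
      (forall x, (fun n => u n x) @ \oo --> f x) ->
      baire_class r a f.

Definition baire_functions (X Y : topologicalType) : set {ptws X -> Y} :=
  [set f | exists2 r : rel nat, wochoice.well_order r &
             exists a : nat, baire_class r a f].
Arguments baire_functions : clear implicits.

Definition stable_baire1 (X Y : topologicalType) : set {ptws X -> Y} :=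
  [set f | exists u : nat -> X -> Y,
     (forall n, continuous (u n)) /\
     forall x, finite_set [set n | u n x <> f x]].
Arguments stable_baire1 : clear implicits.

Definition zero_sets (R : realType) (X : topologicalType) : set (set X) :=
  [set Z | exists2 f : X -> R, continuous f & Z = f @^-1` [set 0]].
Arguments zero_sets : clear implicits.

(* [X] with the Baire topology. *)
Definition baire_space (R : realType) (X : topologicalType) : Type := X.

Section BaireSpace.
Variables (R : realType) (X : topologicalType).

HB.instance Definition _ := Choice.copy (baire_space R X) X.

Lemma zero_sets_cover : \bigcup_(Z in zero_sets R X) Z = setT.
Proof.
apply/seteqP; split=> // x _; exists setT => //.
exists (fun=> 0); first by move=> ?; exact: cvg_cst.
by apply/seteqP; split.
Qed.

Lemma zero_sets_join (A B : set X) (x : X) :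
  zero_sets R X A -> zero_sets R X B -> A x -> B x ->
  exists C, [/\ zero_sets R X C, C x & C `<=` A `&` B].
Proof.
move=> [f cf ->] [g cg ->] fx gx.
exists ((fun y => f y * f y + g y * g y) @^-1` [set 0]); split.
- exists (fun y => f y * f y + g y * g y) => // y.
  by apply: cvgD; apply: cvgM; [exact: cf|exact: cf|exact: cg|exact: cg].
- by rewrite /preimage/= in fx gx *; rewrite fx gx mulr0 addr0.
- move=> y /= /eqP; rewrite -!expr2 paddr_eq0 ?sqr_ge0// !sqrf_eq0.
  by move=> /andP[/eqP ? /eqP ?].
Qed.

HB.instance Definition _ := @isBaseTopological.Build (baire_space R X)
  (set X) (zero_sets R X) id zero_sets_cover zero_sets_join.

End BaireSpace.

Definition omega_cover (Z : Type) (C : set (set Z)) : Prop :=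
  forall F : set Z, finite_set F -> exists2 U, C U & F `<=` U.

Definition property_gamma (Z : topologicalType) : Prop :=
  forall C : set (set Z), (forall U, C U -> open U) -> omega_cover C ->
    exists2 U : nat -> set Z, (forall n, C (U n)) &
      \bigcup_n \bigcap_(i in [set i | (n <= i)%N]) U i = setT.

Definition frechet_urysohn (Z : topologicalType) : Prop :=
  forall (A : set Z) (a : Z), closure A a ->
    exists2 u : nat -> Z, (forall n, A (u n)) & u @ \oo --> a.

Definition sequential (Z : topologicalType) : Prop :=
  forall A : set Z, ~ closed A ->
    exists (u : nat -> Z) (a : Z),
      [/\ forall n, A (u n), (closure A `\` A) a & u @ \oo --> a].

Definition k_space (Z : topologicalType) : Prop :=
  forall A : set Z, ~ closed A ->
    exists2 K : set Z, compact K & ~ closed (A `&` K : set (subspace K)).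

Definition countable_tightness (Z : topologicalType) : Prop :=
  forall (A : set Z) (a : Z), closure A a ->
    exists B : set Z, [/\ countable B, B `<=` A & closure B a].

(* Main.v *)
Require Import Defs.
From mathcomp Require Import all_boot all_order all_algebra.
From mathcomp Require Import all_classical all_reals all_analysis.
From mathcomp Require Import lra.

Set Implicit Arguments.
Unset Strict Implicit.
Unset Printing Implicit Defensive.

Import Order.TTheory GRing.Theory Num.Theory.
Import numFieldNormedType.Exports.
Local Open Scope classical_set_scope.
Local Open Scope ring_scope.

(** Write Z for the space H, and call a subset of X Baire-open if it is open in
the Baire topology.

Zero-sets are closed under countable intersections, so the Baire topology is a
P-topology: countable intersections of Baire-open sets are Baire-open
(open_baire_bigcap).  By induction on the Baire class, every Baire function is
then locally constant for it (baire_class_locally_constant).  In the other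
direction, if E is a finite subset of a Baire-open set U and y0, y1 are points
of Y, some stable limit of continuous functions equals y1 on E and y0 off U
(stable_baire1_separation).  These two facts are all that is retained of the
inclusions between B_1^st(X, Y), H and B(X, Y).

A Frechet-Urysohn space is sequential and a sequential space is a k-space, by
general topology.  The three other implications are as follows.

From countable tightness to the property gamma.  Given an open omega-cover, the
separating functions attached to its members have a constant function in their
closure.  A countable subfamily that keeps this constant in its closure gives a
countable omega-cover W_n, subordinate to the first one and made of clopen sets
(tightness_countable_subcover).  The points that belong to the same W_n form
cells, which are open because the topology is a P-topology; the same argument
applied to finite unions of cells shows that there are countably many cells.  A
member of the cover that contains a W_n containing the first k cells, for each
k, gives the sequence required (tightness_property_gamma).

From the property gamma to the Frechet-Urysohn property.  This is the argument
of Gerlits and Nagy: a is approximated up to 1/(n+1) on sets that form an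
omega-cover for each n, and removing the n-th point of an injective sequence
from the n-th cover forces a gamma-sequence to visit each cover finitely often
(property_gamma_frechet).

From k-space to countable tightness.  This is the main difficulty and has two
halves.  Let y_n be a sequence without cluster point in Y, which exists because
Y is metrizable and not compact (noncompact_sequence).  First, if F_i is a
family of finite subsets of X such that every finite E has a Baire-open
neighbourhood containing only finitely many F_i, then the family is countable
(k_space_finite_trace).  For consider the closed sets A_n of the functions h
such that at most n of the F_i lie in the set where h differs from y_n: their
union is not closed, so a compact set K meets infinitely many of them; but at
each point the values of K avoid y_n for n large, so an uncountable family
would provide more than n indices i with F_i in the set where some h in A_n
and K differs from y_n.

Second, suppose that a is in the closure of A but in the closure of no
countable subset of A.  The union of the closures of the countable subsets of A
is not closed; as Z is a k-space there are a compact set K and a limit b of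
points f of K taken in this union, with b in the closure of no countable set
of such f.  A transfinite recursion of length omega_1 (uncountable_chain)
yields functions f_p and finite sets F_p such that f_q agrees with b on F_p for
p <= q, while f_p is far from b somewhere on F_q for p < q.  A point g of K
near which lie uncountably many f_p agrees with b on every F_p.  Given a finite
E, choose f_p close to g on E; the Baire-open set where f_p is close to g
contains F_q only if q <= p, hence for countably many q.  By the P-property it
can be shrunk to contain only those F_q that are subsets of E, and there are
finitely many of them since the F_q are distinct.  So the first half applies to
the F_p and contradicts their uncountability
(k_space_countable_tightness). *)

(** * Countable and uncountable sets *)

Lemma infinite_set_sequence (T : Type) (A : set T) : infinite_set A ->
  exists2 p : nat -> T, injective p & forall n, A (p n).
Proof.
move=> /infiniteP/card_leP[f]; exists (fun n => \val (f (to_setT n))).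
  move=> m n /val_inj fmn.
  have : to_setT m = to_setT n by apply: inj fmn; rewrite inE.
  by move/(congr1 val).
by move=> n; exact: set_valP.
Qed.

Lemma infinite_nat_unbounded (S : set nat) : infinite_set S ->
  forall N, exists2 n, (N <= n)%N & S n.
Proof.
move=> iS N; apply: contrapT => h; apply: iS.
apply: (@sub_finite_set _ _ `I_N); last exact: finite_II.
by move=> n Sn /=; rewrite ltnNge; apply/negP => Nn; apply: h; exists n.
Qed.

Lemma countable_range (T : Type) (B : set T) : countable B -> B !=set0 ->
  exists u : nat -> T,
    (forall n, B (u n)) /\ forall b, B b -> exists n, u n = b.
Proof.
move=> /countable_injP[f finj] [b0 Bb0].
have /choice[u uP] (n : nat) : exists b, B b /\
    forall b', B b' -> f b' = n -> b = b'.
  have [[b [Bb fb]]|nb] := pselect (exists b, B b /\ f b = n).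
    exists b; split=> // b' Bb' fb'; apply: finj; rewrite ?inE//.
    by rewrite fb fb'.
  by exists b0; split=> // b' Bb' fb'; exfalso; apply: nb; exists b'.
exists u; split=> [n|b Bb]; first by have [] := uP n.
by exists (f b); have [_] := uP (f b); exact.
Qed.

Lemma cocountable_proper (I : Type) (S : set I) : ~ countable S ->
  ProperFilter (fun P : set I => countable (S `\` P)).
Proof.
move=> ncS; apply: Build_ProperFilter_ex; last first.
  split.
  - by rewrite setDT; exact: countable0.
  - move=> P Q cP cQ; rewrite setDIr -bigcup2E.
    by apply: bigcup_countable => // -[|[|i]] _.
  - move=> P Q PQ; apply: sub_countable; apply: subset_card_le => i [Si nQ].
    by split=> // /PQ.
move=> P cP; apply: contrapT => /forallNP nP; apply: ncS.
apply: sub_countable cP; apply: subset_card_le => i Si.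
by split=> //; exact: nP.
Qed.

Section Omega1.
Variables (T : Type) (lt : T -> T -> Prop) (V : set T).
Hypothesis irr : forall q, V q -> ~ lt q q.
Hypothesis ext : forall S : set T, countable S -> S `<=` V ->
  exists2 q, V q & forall p, S p -> lt p q.

Let chain (S : set T) := [/\ S `<=` V,
  forall p q, S p -> S q -> p <> q -> lt p q \/ lt q p &
  forall q, S q -> countable [set p | S p /\ ~ lt q p]].
Let le (S S' : set T) := S `<=` S' /\
  forall p q, S p -> S' q -> ~ S q -> lt p q.

(** A form of transfinite recursion of length omega_1 that avoids ordinals: if
every countable set has a strict upper bound, Zorn's lemma for end-extension
gives a maximal chain in which every element has countably many predecessors,
and an upper bound would extend it if it were countable. *)
Lemma uncountable_chain : exists S : set T, [/\ S `<=` V, ~ countable S,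
  forall p q, S p -> S q -> p <> q -> lt p q \/ lt q p &
  forall q, S q -> countable [set p | S p /\ ~ lt q p]].
Proof.
have c0 : chain set0 by split.
pose C := {S : set T | chain S}.
pose leC (S S' : C) := `[< le (sval S) (sval S') >].
have [||A tot|[S cS] Smax] := @ZL_preorder C (exist _ _ c0) leC.
- by move=> S; apply/asboolP; split.
- move=> S1 S2 S3 /asboolP[s12 l12] /asboolP[s23 l23]; apply/asboolP.
  split=> [|p q Sp Sq nSq]; first exact: subset_trans s23.
  have [/l12|nS2q] := pselect (sval S2 q); first exact.
  by apply: l23 => //; exact: s12.
- pose U := [set p | exists2 S : C, A S & sval S p].
  have AU (S : C) : A S -> le (sval S) U.
    move=> AS; split=> [p Sp|p q Sp [S' AS' S'q] nSq]; first by exists S.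
    have [/asboolP[_ l]|/asboolP[l _]] := tot _ _ AS AS'; first exact: l.
    by have := l _ S'q.
  have cU : chain U.
    split.
    + by move=> p [[S [SV ? ?]] _ /SV].
    + move=> p q [S AS Sp] [S' AS' S'q] pq.
      have [/asboolP[l _]|/asboolP[l _]] := tot _ _ AS AS'.
        by case: (svalP S') => _ h _; apply: h => //; exact: l.
      by case: (svalP S) => _ h _; apply: h => //; exact: l.
    + move=> q [S AS Sq]; have [_ _ /(_ q Sq)] := svalP S.
      apply: sub_countable; apply: subset_card_le => p [Up nqp]; split=> //.
      by apply: contrapT => nSp; apply: nqp; have [_] := AU S AS; exact.
  by exists (exist _ U cU) => S AS; apply/asboolP; exact: AU.
exists S; case: (cS) => SV Slin Spre; split=> // Scount.
have [q Vq Sq] := ext Scount SV.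
have nSq : ~ S q by move=> /Sq; exact: irr.
pose S' := S `|` [set q].
have cS' : chain S'.
  split.
  - by move=> p [/SV|->].
  - move=> p r [Sp|->] [Sr|->] // pr; first exact: Slin.
      by left; exact: Sq.
    by right; exact: Sq.
  - move=> p _; apply: (@sub_countable _ _ _ S'); last first.
      by rewrite /S' -bigcup2E; apply: bigcup_countable => // -[|[|i]] _ /=.
    by apply: subset_card_le => r [].
have /Smax/asboolP[/(_ q) + _] : leC (exist _ S cS) (exist _ S' cS').
  apply/asboolP.
  by split=> /= [p Sp|p r Sp [Sr|->] nSr]; [left|by []|exact: Sq].
by move=> /(_ (or_intror erefl)).
Qed.
End Omega1.

(** * Sequential spaces, k-spaces and cluster points *)

Lemma frechet_urysohn_sequential (Z : topologicalType) :
  frechet_urysohn Z -> sequential Z.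
Proof.
move=> fu A ncA; have [a [clAa nAa]] : exists a, closure A a /\ ~ A a.
  apply: contrapT => h; apply: ncA => a clAa; apply: contrapT => nAa.
  by apply: h; exists a.
by have [u uA ua] := fu A a clAa; exists u, a.
Qed.

(** A convergent sequence together with its limit is compact, and the trace
on it of a set that contains the sequence but not the limit is not closed. *)
Lemma sequential_k_space (Z : topologicalType) : sequential Z -> k_space Z.
Proof.
move=> sq A ncA; have [u [a [uA [clA nAa] ua]]] := sq A ncA.
exists (range u `|` [set a]).
  (* A filter on this set either clusters at the limit or lives on finitely
     many terms of the sequence. *)
  move=> F PF FK; have [cla|ncla] := pselect (cluster F a).
    by exists a; split=> //; right.
  have [B [V [FB aV BV]]] : exists B V, [/\ F B, nbhs a V & B `&` V = set0].
    apply: contrapT => h; apply: ncla => B V FB aV; apply/set0P/eqP => BV.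
    by apply: h; exists B, V.
  have [N _ NV] := ua V aV.
  have cK : compact (u @` `I_N) by apply: finite_compact; exact: finite_image.
  have [|c [[n nN <-] cln]] := cK F PF.
    apply: filterS (filterI FK FB) => z [[[n _ <-]|->] Bz].
      exists n => //=; rewrite ltnNge; apply/negP => Nn.
      have : (B `&` V) (u n) by split=> //; exact: NV.
      by rewrite BV.
    have : (B `&` V) a by split=> //; exact: nbhs_singleton.
    by rewrite BV.
  by exists (u n); split=> //; left; exists n.
move=> /closed_subspaceP[V cV VE]; apply: nAa.
have Va : V a.
  apply: cV; apply: (closureS (_ : range u `<=` V)); last first.
    move=> B /ua[N _ NB]; exists (u N).
    by split; [exists N|exact: NB (leqnn N)].
  move=> _ [n _ <-].
  have : ((A `&` (range u `|` [set a])) `&` (range u `|` [set a])) (u n).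
    by split; [split=> //|]; left; exists n.
  by rewrite -VE => -[].
have : (V `&` (range u `|` [set a])) a by split=> //; right.
by rewrite VE => -[[]].
Qed.

(** A compact set on which the union is not closed cannot meet only finitely
many of the closed sets. *)
Lemma k_space_closed_family (Z : topologicalType) (A : nat -> set Z) :
  k_space Z -> (forall n, closed (A n)) -> ~ closed (\bigcup_n A n) ->
  exists2 K, compact K & forall N, exists n h, [/\ (N <= n)%N, A n h & K h].
Proof.
move=> kZ cA ncA; have [K cK ncK] := kZ _ ncA; exists K => // N.
apply: contrapT => h; apply: ncK; apply/closed_subspaceP.
exists (\bigcup_(n in `I_N) A n); first exact: closed_bigcup.
rewrite -setIA setIid; apply/seteqP.
split=> z [[n nN Anz] Kz]; split=> //; exists n => //=.
by rewrite ltnNge; apply/negP => Nn; apply: h; exists n, z.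
Qed.

(** Cluster points of an indexed family in a compact set along any filter on the
indices.  It serves for sequences, for subsequences, and for uncountable
families with the cocountable filter. *)
Lemma compact_cluster_family (Z : topologicalType) (K : set Z) (I : Type)
    (F : set_system I) (u : I -> Z) : compact K -> ProperFilter F ->
  F [set i | K (u i)] ->
  exists2 g, K g & forall V P, nbhs g V -> F P -> exists2 i, P i & V (u i).
Proof.
move=> cK PF FK; have [g [Kg clg]] := cK (u @ F) _ FK.
exists g => // V P gV FP.
have [_ [[i Pi <-] Vi]] : (u @` P) `&` V !=set0.
  apply: clg => //; apply: (@filterS _ F _ P) => // i Pi.
  by exists i.
by exists i.
Qed.

Lemma within_infinite_proper (S : set nat) : infinite_set S ->
  ProperFilter (within S \oo).
Proof.
move=> iS; apply: Build_ProperFilter_ex => P [N _ NP].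
by have [n Nn Sn] := infinite_nat_unbounded iS N; exists n; exact: NP.
Qed.

(** * Zero-sets and the Baire topology *)

Section BaireTopology.
Variables (R : realType) (X : topologicalType).
Local Notation XB := (baire_space R X).

Lemma open_baireP (U : set XB) : open U <-> forall x : X, U x ->
  exists h : X -> R, [/\ continuous h, h x = 0 & forall z, h z = 0 -> U z].
Proof.
split=> [[D' sD <-] x [A D'A Ax]|hU].
  have [h ch Ah] := sD _ D'A; exists h; split=> //.
    by move: Ax; rewrite Ah.
  by move=> z hz; exists A => //; rewrite Ah.
exists [set A | zero_sets R X A /\ A `<=` U]; first by move=> A [].
apply/seteqP; split=> [x [A [_ AU]]|x Ux]; first exact: AU.
have [h [ch hx hU0]] := hU x Ux.
by exists (h @^-1` [set 0]) => //=; split=> //; exists h.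
Qed.

(** The supremum of the functions |h_n| truncated at 1/(n+1) is continuous: up
to any positive error only finitely many of them matter. *)
Lemma zero_set_bigcap (h : nat -> X -> R) : (forall n, continuous (h n)) ->
  exists2 k : X -> R, continuous k &
    forall z, k z = 0 <-> forall n, h n z = 0.
Proof.
move=> ch.
pose t n z := Num.min `|h n z| n.+1%:R^-1.
have t_ge0 n z : 0 <= t n z by rewrite le_min normr_ge0 invr_ge0 ler0n.
have t_le n z : t n z <= n.+1%:R^-1 by rewrite ge_min lexx orbT.
have t_le1 n z : t n z <= 1.
  by apply: le_trans (t_le n z) _; rewrite invf_le1 ?ltr0n// ler1n.
pose k z := sup (range (t^~ z)).
have t_k n z : t n z <= k z.
  by apply: sup_ubound; [exists 1 => _ [m _ <-]; exact: t_le1|exists n].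
have k_le z c : (forall n, t n z <= c) -> k z <= c.
  move=> tc; apply: ge_sup; first by exists (t 0%N z), 0%N.
  by move=> _ [m _ <-].
exists k => [x|z]; last first.
  split=> [kz n|hz]; last first.
    apply/eqP; rewrite eq_le (le_trans (t_ge0 0%N z) (t_k _ _)) andbT.
    by apply: k_le => n; rewrite /t hz normr0 ge_min lexx.
  have : t n z <= 0 by rewrite -kz.
  by rewrite /t ge_min normr_le0 (lt_geF (_ : 0 < n.+1%:R^-1)) ?orbF// => /eqP.
apply/cvgrPdist_le => e e0.
have [N Ne] : exists N : nat, N.+1%:R^-1 < e.
  have [N _ /(_ N (leqnn N))] := near_infty_natSinv_lt (PosNum e0).
  by exists N.
have near_h : \forall z \near x, forall n, (n < N)%N -> `|h n x - h n z| <= e.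
  elim: N {Ne} => [|N IH]; first exact: filterE.
  near=> z => n; rewrite ltnS leq_eqVlt => /orP[/eqP ->|].
    by near: z; move/cvgrPdist_le : (ch N x); exact.
  by move: n; near: z.
near=> z.
have hz : forall n, (n < N)%N -> `|h n x - h n z| <= e by near: z.
have tE n : `|t n x - t n z| <= e.
  have [nN|Nn] := ltnP n N.
    apply: le_trans (hz n nN).
    apply: le_trans (ler_dist_dist _ _).
    rewrite /t ler_norml; move: `|h n x| `|h n z| n.+1%:R^-1 => a b c.
    by case: (leP a c); case: (leP b c); case: (ger0P (a - b)); lra.
  have ne : n.+1%:R^-1 <= e.
    apply: le_trans (ltW Ne); rewrite lef_pV2 ?posrE ?ltr0n// ler_nat ltnS //.
  have := t_ge0 n x; have := t_ge0 n z; have := t_le n x; have := t_le n z.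
  rewrite ler_norml; move: (t n x) (t n z) n.+1%:R^-1 ne => a b c *.
  by apply/andP; split; lra.
have kx_le : k x <= k z + e.
  apply: k_le => n; have := tE n; have := t_k n z.
  by rewrite ler_norml => + /andP[]; lra.
have kz_le : k z <= k x + e.
  apply: k_le => n; have := tE n; have := t_k n x.
  by rewrite ler_norml => + /andP[]; lra.
by rewrite ler_norml; apply/andP; split; lra.
Unshelve. all: end_near. Qed.

Lemma open_baire_zero_set (h : X -> R) : continuous h ->
  open ([set z | h z = 0] : set XB).
Proof. by move=> ch; apply/open_baireP => x hx; exists h. Qed.

(** The Baire topology is a P-topology: G_delta sets are open. *)
Lemma open_baire_bigcap (U : nat -> set XB) : (forall n, open (U n)) ->
  open (\bigcap_n U n).
Proof.
move=> oU; apply/open_baireP => x Ux.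
have /choice[h hP] n := (open_baireP (U n)).1 (oU n) x (Ux n I).
have [|k ck k0] := @zero_set_bigcap h; first by move=> n; have [] := hP n.
exists k; split=> //; first by apply/k0 => n; have [] := hP n.
by move=> z /k0 hz n _; have [_ _] := hP n; exact.
Qed.

Lemma open_baire_finite_zero_set (U : set XB) (E : seq X) : open U ->
  (forall x, x \in E -> U x) ->
  exists h : X -> R, [/\ continuous h, forall x, x \in E -> h x = 0 &
    forall z, h z = 0 -> U z].
Proof.
move=> /open_baireP oU; elim: E => [|x E IH] EU.
  exists (fun=> 1); split=> // [|z /eqP]; last by rewrite oner_eq0.
  by move=> z; exact: cvg_cst.
have [|h [ch hE hU]] := IH.
  by move=> y yE; apply: EU; rewrite in_cons yE orbT.
have [k [ck kx kU]] := oU x (EU x (mem_head _ _)).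
exists (fun z => h z * k z); split.
- by move=> z; apply: cvgM; [exact: ch|exact: ck].
- move=> y; rewrite in_cons => /orP[/eqP ->|/hE ->]; last by rewrite mul0r.
  by rewrite kx mulr0.
- by move=> z /eqP; rewrite mulf_eq0 => /orP[/eqP/hU|/eqP/kU].
Qed.

End BaireTopology.

(** * Metrizable targets *)

Section MetrizableTarget.
Variables (R : realType) (X Y : topologicalType) (d : Y -> Y -> R).
Hypothesis md : is_metric d.
Hypothesis nbhsY : forall (y : Y) (A : set Y),
  nbhs y A <-> exists2 e : R, 0 < e & [set z | d y z < e] `<=` A.
Local Notation XB := (baire_space R X).

Let d0 y : d y y = 0. Proof. by case: md => _ h _ _; apply/h. Qed.
Let dC y z : d y z = d z y. Proof. by case: md. Qed.
Let dT y z t : d y t <= d y z + d z t. Proof. by case: md. Qed.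
Let dge0 y z : 0 <= d y z. Proof. by case: md. Qed.
Let d_eq0 y z : d y z = 0 -> y = z. Proof. by case: md => _ h _ _ /h. Qed.
Let d_gt0 y z : y <> z -> 0 < d y z.
Proof.
by move=> yz; rewrite lt_neqAle dge0 andbT eq_sym; apply/eqP => /d_eq0.
Qed.
Let d_squeeze y z : (forall e, 0 < e -> d y z <= e) -> y = z.
Proof.
move=> h; apply/d_eq0/eqP; rewrite eq_le dge0 andbT.
by apply/ler_addgt0Pr => e e0; rewrite add0r; exact: h.
Qed.

Lemma nbhs_dist (y : Y) (e : R) : 0 < e -> nbhs y [set z | d y z < e].
Proof. by move=> e0; apply/nbhsY; exists e. Qed.

(** A ball of radius e / 2 contains at most one term of an e-separated
sequence. *)
Lemma not_totally_bounded_sequence (e : R) : 0 < e ->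
  (forall s : seq Y, exists p, forall c, c \in s -> e <= d c p) ->
  exists y : nat -> Y, forall p, finite_set [set n | d p (y n) < e / 2].
Proof.
move=> e0 /choice[N NP].
pose L := fix L n := if n is m.+1 then N (L m) :: L m else [::].
have inL i n : (i < n)%N -> N (L i) \in L n.
  elim: n => // n IH; rewrite ltnS leq_eqVlt /= inE => /orP[/eqP ->|/IH ->].
    by rewrite eqxx.
  by rewrite orbT.
exists (fun n => N (L n)) => p.
have sep i j : (i < j)%N ->
    d p (N (L i)) < e / 2 -> d p (N (L j)) < e / 2 -> False.
  move=> /inL /NP ij pi pj; have := dT (N (L i)) p (N (L j)).
  by rewrite (dC _ p); lra.
have [[i pi]|h] := pselect (exists i, d p (N (L i)) < e / 2); last first.
  rewrite (_ : [set n | _] = set0) //; apply/seteqP; split=> // n pn.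
  by apply: h; exists n.
apply: (@sub_finite_set _ _ [set i]) => // j /= pj.
by case: (ltngtP i j) => // ij; [have := sep i j ij|have := sep j i ij]; case.
Qed.

(** An ultrafilter on a totally bounded space contains balls B(c_n, 1/(n+1)) for
all n.  If w_n lies in the first n + 1 of them, a point near which infinitely
many w_n lie is a limit of the ultrafilter; so a filter without cluster point
provides a sequence without cluster point. *)
Lemma totally_bounded_sequence : ~ compact [set: Y] ->
  (forall e : R, 0 < e -> exists s : seq Y, forall p,
    exists2 c, c \in s & d c p < e) ->
  exists y : nat -> Y, forall p, exists2 e : R,
    0 < e & finite_set [set n | d p (y n) < e].
Proof.
move=> /existsNP[F /not_implyP[PF /not_implyP[_ ncl]]] tb.
have [G [UG FG]] := ultraFilterLemma PF.
have /choice[c cG] (n : nat) :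
    exists c : Y, G [set p | d c p < n.+1%:R^-1].
  have n0 : 0 < n.+1%:R^-1 :> R by [].
  have [s sP] := tb _ n0.
  apply: contrapT => /forallNP nG.
  have : G [set p | forall c, c \in s -> ~ d c p < n.+1%:R^-1].
    elim: s {sP} => [|c s IH]; first by apply: filterE => p c; rewrite in_nil.
    have := in_ultra_setVsetC [set p | d c p < n.+1%:R^-1] UG.
    case=> [/nG//|cC]; apply: filterS (filterI cC IH) => p [/= pc ps] c'.
    by rewrite in_cons => /orP[/eqP ->|/ps].
  move=> /filter_ex[p ps]; have [c' c's c'p] := sP p.
  exact: (ps c' c's c'p).
have /choice[w wP] (n : nat) :
    exists w : Y, forall i, (i <= n)%N -> d (c i) w < i.+1%:R^-1.
  suff /filter_ex[w hw] :
      G [set w | forall i, (i <= n)%N -> d (c i) w < i.+1%:R^-1] by exists w.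
  elim: n => [|n IH].
    by apply: filterS (cG 0%N) => p /= p0 i; rewrite leqn0 => /eqP ->.
  apply: filterS (filterI (cG n.+1) IH) => p [/= p0 pn] i.
  by rewrite leq_eqVlt ltnS => /orP[/eqP ->|/pn].
exists w => p; apply: contrapT => np; apply: ncl; exists p; split=> //.
move=> A B FA /nbhsY[e e0 eB].
have e40 : 0 < e / 4 by rewrite divr_gt0.
have [k _ /(_ k (leqnn k)) /= ke] := near_infty_natSinv_lt (PosNum e40).
have iS : infinite_set [set n | d p (w n) < e / 4].
  by move=> fS; apply: np; exists (e / 4).
have [n kn /= pn] := infinite_nat_unbounded iS k.
have [q [Aq /= cq]] := filter_ex (filterI (FG _ FA) (cG k)).
exists q; split=> //; apply: eB => /=.
have := wP n k kn; have := dT p (w n) q; have := dT (w n) (c k) q.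
rewrite (dC (w n) (c k)); move: (k.+1%:R^-1) ke cq => b; lra.
Qed.

Lemma noncompact_sequence : ~ compact [set: Y] ->
  exists (ystar : Y) (y : nat -> Y), (forall n, y n <> ystar) /\
    forall p, exists2 e : R, 0 < e & finite_set [set n | d p (y n) < e].
Proof.
move=> ncY.
have [y yP] : exists y : nat -> Y, forall p, exists2 e : R,
    0 < e & finite_set [set n | d p (y n) < e].
  have [tb|] := pselect (forall e : R, 0 < e -> exists s : seq Y, forall p,
      exists2 c, c \in s & d c p < e).
    exact: totally_bounded_sequence.
  move=> /existsNP[e /not_implyP[e0 ns]].
  have [s|y yP] := @not_totally_bounded_sequence e e0.
    have /existsNP[p np] := (forallNP _).2 ns s.
    exists p => c cs; rewrite leNgt; apply/negP => cp; apply: np.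
    by exists c.
  by exists y => p; exists (e / 2); [rewrite divr_gt0|exact: yP].
pose S := [set n | y n = y 0%N].
have fS : finite_set S.
  have [e e0 fe] := yP (y 0%N); apply: sub_finite_set fe => n /= ->.
  by case: md => _ h _ _; rewrite (h _ _).2.
have [N NS] : exists N, forall n, (N <= n)%N -> ~ S n.
  apply: contrapT => h; apply: infinite_nat.
  have -> : [set: nat] = \bigcup_(m in S) `I_m.+1; last exact: bigcup_finite.
  apply/seteqP; split=> // n _; apply: contrapT => nS; apply: h; exists n.
  by move=> m nm Sm; apply: nS; exists m => //=; rewrite ltnS.
exists (y 0%N), (fun n => y (N + n)%N); split=> [n|p].
  exact: NS (leq_addr _ _).
have [e e0 fe] := yP p; exists e => //.
apply: (@finite_preimage _ _ [set n | d p (y n) < e] (addn N)) => //.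
by move=> i j _ _ /addnI.
Qed.

(** * Functions locally constant for the Baire topology *)

Lemma metric_hausdorff : hausdorff_space Y.
Proof.
move=> p q clpq; apply: d_squeeze => e e0.
have e20 : 0 < e / 2 by rewrite divr_gt0.
have [z [/= pz qz]] := clpq _ _ (nbhs_dist p e20) (nbhs_dist q e20).
by apply: le_trans (dT p z q) _; rewrite (dC z q); lra.
Qed.

Lemma continuous_dist (y : Y) (f : X -> Y) : continuous f ->
  continuous (fun z => d y (f z)).
Proof.
move=> cf x; apply/cvgrPdist_lt => e e0.
suff fS : forall z, d (f x) (f z) < e -> `|d y (f x) - d y (f z)| < e.
  exact: (filterS fS (cf x _ (nbhs_dist (f x) e0))).
move=> z fz.
have := dT y (f x) (f z); have := dT y (f z) (f x); rewrite (dC (f z)) => *.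
by rewrite ltr_norml; apply/andP; split; lra.
Qed.

Definition baire_locally_constant (f : X -> Y) :=
  forall x, open ([set z | f z = f x] : set XB).

(** At a limit stage, the approximating functions are all constant on a common
Baire neighbourhood of a given point, by the P-property, and hence so is their
limit. *)
Lemma baire_class_locally_constant (r : rel nat) (a : nat) (f : X -> Y) :
  baire_class r a f -> baire_locally_constant f.
Proof.
elim=> {a f} [a f _ cf x|a f u b _ _ IH uf x].
  have -> : [set z | f z = f x] = [set z | d (f x) (f z) = 0].
    by apply/seteqP; split=> z /= => [->|/d_eq0].
  exact: (open_baire_zero_set (continuous_dist cf)).
rewrite openE => z fz; rewrite /interior.
have oJ := open_baire_bigcap (fun n => IH n z).
rewrite nbhsE /=; exists (\bigcap_n [set t | u n t = u n z]); first by split.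
move=> t ut; rewrite /= -fz.
apply: (@cvg_unique _ metric_hausdorff _ _ _ _ (uf t)).
suff -> : (fun n => u n t) = (fun n => u n z) by exact: uf.
by apply/funext => n; exact: ut.
Qed.

(** Locally constant functions behave as maps into a discrete space: any
condition on their values is open. *)
Lemma open_locally_constant2 (P : Y -> Y -> Prop) (f g : X -> Y) :
  baire_locally_constant f -> baire_locally_constant g ->
  open ([set x | P (f x) (g x)] : set XB).
Proof.
move=> lf lg; rewrite openE => x Px; rewrite /interior nbhsE.
exists ([set z | f z = f x] `&` [set z | g z = g x]).
  by split=> //; apply: openI; [exact: lf|exact: lg].
by move=> z [/= -> ->].
Qed.

Section Tychonoff.
Hypothesis XY : Y_tychonoff X Y.

Lemma tychonoff_indicator (A : set X) (E : seq X) (y0 y1 : Y) : closed A ->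
  (forall x, x \in E -> ~ A x) ->
  exists g : X -> Y, [/\ continuous g, forall x, x \in E -> g x = y1 &
    forall x, A x -> g x = y0].
Proof.
move=> cA EA.
have [|g [cg gE gA]] := XY y0 (fun _ : [set` E] => y1) cA (finite_seq E).
  by move=> x /= xE; exact: EA.
exists g; split=> // [x xE|x Ax].
  by have := gE (SigSub (mem_set (xE : [set` E] x))).
by have /(_ (g x)) := gA; apply; exists x.
Qed.

Lemma baire_open_setC1 (y0 y1 : Y) (x : X) : y1 <> y0 ->
  open (~` [set x] : set XB).
Proof.
move=> y10; apply/open_baireP => z /= zx.
pose f (u : [set` [:: x; z]]) := if \val u == x then y0 else y1.
have [|g [cg gE _]] := XY y0 f (@closed0 X) (finite_seq _).
  by move=> t _ [].
have gx : g x = y0.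
  have xE : [set` [:: x; z]] x by rewrite /= mem_head.
  by have := gE (SigSub (mem_set xE)); rewrite /f /= eqxx.
have gz : g z = y1.
  have zE : [set` [:: x; z]] z by rewrite /= !inE eqxx orbT.
  have := gE (SigSub (mem_set zE)); rewrite /f /=.
  by case: eqP => [/zx//|].
exists (fun t => d y1 (g t)); split; [exact: continuous_dist|by rewrite gz d0|].
by move=> t /d_eq0 gt tx; apply: y10; rewrite gt tx.
Qed.

(** Let U be cut down to the zero-set of some k containing E.  One builds
continuous functions g_n with value y1 on E and y0 where h_n >= 1/(n+1), with
h_0 = |k| and h_(n+1) = h_n + d(y1, g_n).  Where h_n < 1/(n+1) for all n,
monotonicity makes all h_n vanish, so that k = 0 and every g_n equals y1;
elsewhere h_n >= 1/(n+1) from some n on, so that g_n eventually equals y0.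
Thus g_n stabilises at every point.  Letting h_n record the distances from the
earlier g_i to y1 is what makes the values stabilise on the zero-set, since Y
need not contain an arc through which to interpolate. *)
Lemma stable_baire1_separation (U : set XB) (E : seq X) (y0 y1 : Y) : open U ->
  (forall x, x \in E -> U x) ->
  exists f : X -> Y, [/\ stable_baire1 X Y f, forall x, x \in E -> f x = y1 &
    forall x, ~ U x -> f x = y0].
Proof.
move=> oU EU; have [k [ck kE kU]] := open_baire_finite_zero_set oU EU.
pose good (h : X -> R) := [/\ continuous h, forall x, 0 <= h x &
  forall x, x \in E -> h x = 0].
have exG (p : (X -> R) * nat) : exists g : X -> Y, good p.1 ->
    [/\ continuous g, forall x, x \in E -> g x = y1 &
       forall x, p.2.+1%:R^-1 <= p.1 x -> g x = y0].
  case: p => h n /=; have [[ch h0 hE]|] := pselect (good h); last first.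
    by exists (fun=> y0).
  pose A := [set x | n.+1%:R^-1 <= h x].
  have [||g [cg gE gA]] := @tychonoff_indicator A E y0 y1.
  - have -> : A = h @^-1` [set t | n.+1%:R^-1 <= t] by [].
    by apply: closed_comp => [x _|]; [exact: ch|exact: closed_ge].
  - move=> x xE; rewrite /A /= hE// => n0.
    by have : 0 < n.+1%:R^-1 :> R by []; rewrite ltNge n0.
  - by exists g.
have /choice[G GP] := exG.
pose fix h n : X -> R :=
  if n is m.+1 then fun z => h m z + d y1 (G (h m, m) z) else fun z => `|k z|.
pose g n := G (h n, n).
have hS n z : h n.+1 z = h n z + d y1 (g n z) by [].
have gh n : good (h n).
  elim: n => [|n [ch h0 hE]].
    split=> [x|x|x xE]; rewrite /= ?normr_ge0 ?kE ?normr0//.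
    by apply: cvg_norm; exact: ck.
  have [cg gE _] := GP (h n, n) (And3 ch h0 hE).
  split=> [x|x|x xE]; rewrite ?hS.
  - apply: cvgD; [exact: ch|exact: continuous_dist].
  - by rewrite addr_ge0.
  - by rewrite hE // add0r /g gE // d0.
have hmono m n z : (m <= n)%N -> h m z <= h n z.
  move=> /subnK <-; elim: (n - m)%N => // i IH.
  by rewrite addSn hS; apply: le_trans IH _; rewrite lerDl.
have hall z : (forall n, h n z < n.+1%:R^-1) -> forall i, h i z = 0.
  move=> hz i; apply/eqP; rewrite eq_le; have [_ -> _] := gh i; rewrite andbT.
  apply/ler_addgt0Pr => e e0; rewrite add0r.
  have [N _ Ne] := near_infty_natSinv_lt (PosNum e0).
  apply: le_trans (hmono i (maxn i N) z (leq_maxl _ _)) _.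
  by apply: le_trans (ltW (hz _)) (ltW (Ne _ (leq_maxr _ _))).
exists (fun z => if `[< forall n, h n z < n.+1%:R^-1 >] then y1 else y0); split.
- exists g; split=> [n|x]; first by have [] := GP (h n, n) (gh n).
  case: asboolP => [hx|].
    rewrite (_ : [set n | _] = set0) //; apply/seteqP; split=> // n /=; apply.
    by apply/esym/d_eq0; have := hS n x; rewrite !hall// add0r.
  move=> /existsNP[N /negP]; rewrite -leNgt => Nh.
  apply: (@sub_finite_set _ _ `I_N); last exact: finite_II.
  move=> n /= gn; rewrite ltnNge; apply/negP => Nn; apply: gn.
  have [_ _] := GP (h n, n) (gh n); apply => /=.
  apply: le_trans (hmono _ _ _ Nn); apply: le_trans Nh.
  by rewrite lef_pV2 ?posrE ?ltr0n// ler_nat.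
- move=> x xE; case: asboolP => // -[] n; have [_ _ hE] := gh n.
  by rewrite hE.
- move=> x nUx; case: asboolP => // /hall/(_ 0%N)/eqP.
  by rewrite /= normr_eq0 => /eqP/kU.
Qed.

(** * Spaces of functions under pointwise convergence *)

(** The initial topology of a subspace of a product has the usual base; for the
direct implication, the filter generated by this base converges to a in each
coordinate, hence in the product. *)
Lemma nbhs_set_ptws (H : set {ptws X -> Y}) (a : set_type H)
    (P : set (set_type H)) :
  nbhs a P <-> exists (F : seq X) (e : R), 0 < e /\
    [set h : set_type H | forall x, x \in F -> d (\val a x) (\val h x) < e]
      `<=` P.
Proof.
split; last first.
  move=> [F [e [e0 FP]]].
  have ev x : \forall h \near a, d (\val a x) (\val h x) < e.
    have c1 : continuous (\val : set_type H -> {ptws X -> Y}).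
      exact: initial_continuous.
    have c2 : continuous (fun f : {ptws X -> Y} => f x).
      exact: (@proj_continuous X (fun=> Y) x).
    exact: (c1 a _ (c2 (\val a) _ (nbhs_dist (\val a x) e0))).
  suff : \forall h \near a, forall x, x \in F -> d (\val a x) (\val h x) < e.
    exact: filterS.
  elim: F {FP} => [|x F IH]; first by apply: filterE => h y; rewrite in_nil.
  near=> h => y; rewrite in_cons => /orP[/eqP ->|].
    by near: h; exact: ev.
  by move: y; near: h.
move=> aP.
pose B (p : seq X * R) := [set f : {ptws X -> Y} |
  forall x, x \in p.1 -> d (\val a x) (f x) < p.2].
pose G : set_system {ptws X -> Y} :=
  filter_from [set p : seq X * R | 0 < p.2] B.
have FG : Filter G.
  apply: filter_from_filter; first by exists ([::], 1) => /=.
  move=> [F e] [F' e'] /= e0 e'0; exists (F ++ F', Num.min e e') => /=.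
    by rewrite lt_min e0.
  move=> h hh; split=> x xF.
    by have := hh x; rewrite mem_cat xF /= lt_min => /(_ isT)/andP[].
  by have := hh x; rewrite mem_cat xF orbT /= lt_min => /(_ isT)/andP[].
have GA : G --> (\val a : {ptws X -> Y}).
  apply/cvg_sup => x P' [_ [[D oD <-] Da DP']].
  have /nbhsY[e e0 eD] : nbhs (\val a x) D by apply: open_nbhs_nbhs.
  by exists ([:: x], e) => //= f fe; apply/DP'/eD/fe; rewrite mem_head.
move: aP => [_ [[C oC <-] Ca CP]].
have [[F e] /= e0 FeC] := GA C (open_nbhs_nbhs (conj oC Ca)).
by exists F, e; split=> // h hF; apply/CP/FeC.
Unshelve. all: end_near. Qed.

Section FunctionSpace.

Variables (Z : topologicalType) (ev : Z -> X -> Y).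
Hypothesis nbhsZ : forall (a : Z) (P : set Z),
  nbhs a P <-> exists (F : seq X) (e : R), 0 < e /\
    [set h | forall x, x \in F -> d (ev a x) (ev h x) < e] `<=` P.

Hypothesis ev_locally_constant : forall h, baire_locally_constant (ev h).
Hypothesis ev_stable : forall f, stable_baire1 X Y f -> exists h, ev h = f.

Lemma nbhs_finite_ball (a : Z) (F : seq X) (e : R) : 0 < e ->
  nbhs a [set h | forall x, x \in F -> d (ev a x) (ev h x) < e].
Proof. by move=> e0; apply/nbhsZ; exists F, e; split. Qed.

Lemma closure_finite_ball (A : set Z) (a : Z) :
  closure A a <-> forall (F : seq X) (e : R), 0 < e ->
    exists2 h, A h & forall x, x \in F -> d (ev a x) (ev h x) < e.
Proof.
split=> [clA F e e0|h B /nbhsZ[F [e [e0 FB]]]].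
  by have [h [Ah hF]] := clA _ (nbhs_finite_ball a F e0); exists h.
by have [g Ag gF] := h F e e0; exists g; split=> //; exact: FB.
Qed.

Lemma cvg_pointwise (u : nat -> Z) (a : Z) :
  (forall x e, 0 < e -> \forall n \near \oo, d (ev a x) (ev (u n) x) < e) ->
  u @ \oo --> a.
Proof.
move=> h P /nbhsZ[F [e [e0 FP]]].
suff : \forall n \near \oo, forall x, x \in F -> d (ev a x) (ev (u n) x) < e.
  by apply: filterS => n; exact: FP.
elim: F {FP} => [|x F IH]; first by apply: filterE => h' y; rewrite in_nil.
near=> n => y; rewrite in_cons => /orP[/eqP ->|].
  by near: n; exact: h.
by move: y; near: n.
Unshelve. all: end_near. Qed.

(** * From countable tightness to the property gamma, and back to sequences *)

Lemma ev_cst (y : Y) : exists h : Z, ev h = fun=> y.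
Proof.
apply: ev_stable; exists (fun _ _ => y); split=> [n x|x]; first exact: cvg_cst.
by rewrite (_ : [set n | _] = set0)//; apply/seteqP; split=> // n /=; apply.
Qed.

(** The constant y1 is in the closure of the functions that equal y0 off some
member of the cover; a countable set of such functions with y1 in its closure
yields the sets where these functions differ from y0. *)
Lemma tightness_countable_subcover (y0 y1 : Y) : y1 <> y0 ->
  countable_tightness Z ->
  forall C : set (set XB), (forall U, C U -> open U) -> omega_cover C ->
  exists W : nat -> set X,
  [/\ forall n x, open ([set z | W n z <-> W n x] : set XB),
    forall n, exists2 U, C U & W n `<=` U &
    forall E : seq X, exists n, forall x, x \in E -> W n x].
Proof.
move=> y10 tight C oC wC; have [a aE] := ev_cst y1.
pose A := [set h : Z | exists2 U, C U & forall x, ~ U x -> ev h x = y0].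
have clA : closure A a.
  apply/closure_finite_ball => E e e0.
  have [U CU EU] := wC [set` E] (finite_seq E).
  have [f [sf fE fU]] :=
    stable_baire1_separation y0 y1 (oC _ CU) (fun x => EU x).
  have [h hf] := ev_stable sf; exists h; first by exists U => //; rewrite hf.
  by move=> x xE; rewrite hf fE // aE d0.
have [B [cB BA clB]] := tight A a clA.
have /closure_finite_ball clB' := clB.
have [b0 Bb0 _] := clB' [::] 1 ltr01.
have [u [Bu uB]] := countable_range cB (ex_intro _ _ Bb0).
exists (fun n => [set x | ev (u n) x <> y0]); split=> [n x|n|E].
- exact: (@open_locally_constant2 (fun y _ => y <> y0 <-> ev (u n) x <> y0)
    _ _ (ev_locally_constant (u n)) (ev_locally_constant (u n))).
- have [U CU Uu] := BA _ (Bu n); exists U => // x /= ux.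
  by apply: contrapT => /Uu.
- have [b Bb bE] := clB' E (d y1 y0) (d_gt0 y10).
  have [n un] := uB b Bb; exists n => x xE /= unx.
  by have := bE x xE; rewrite -un unx aE ltxx.
Qed.

Lemma tightness_property_gamma (y0 y1 : Y) : y1 <> y0 ->
  countable_tightness Z -> property_gamma XB.
Proof.
move=> y10 tight C oC wC.
have sub := tightness_countable_subcover y10 tight.
have [W [oW WC WE]] := sub C oC wC.
pose cell x : set XB := \bigcap_n [set z | W n z <-> W n x].
pose C2 := [set U : set XB | exists E : seq X,
  U = \bigcup_(x in [set` E]) cell x].
have [|F /finite_seqP[E ->]|V [_ VC VE]] := sub C2.
- move=> _ [E ->]; apply: bigcup_open => x _.
  by apply: open_baire_bigcap => n; exact: oW.
- by exists (\bigcup_(x in [set` E]) cell x); [exists E|move=> x xE; exists x].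
have /choice[E EV] n :
    exists E : seq X, V n `<=` \bigcup_(x in [set` E]) cell x.
  by have [_ [E ->] ?] := VC n; exists E.
have /choice[U UP] k : exists U, C U /\
    exists2 n, W n `<=` U & forall i x, (i <= k)%N -> x \in E i -> W n x.
  have [n Wn] := WE (flatten [seq E i | i <- iota 0 k.+1]).
  have [U CU WU] := WC n; exists U; split=> //; exists n => // i x ik xE.
  apply: Wn; apply/flattenP; exists (E i) => //; apply/mapP; exists i => //.
  by rewrite mem_iota add0n ltnS.
exists U => [n|]; first by have [] := UP n.
apply/seteqP; split=> // z _.
have [i /(_ z (mem_head _ _)) /EV[x /= xE zx]] := VE [:: z].
exists i => // k /= ik; have [_ [n WU WnE]] := UP k.
by apply: WU; apply/(zx n I); exact: WnE ik xE.
Qed.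

(** If X is finite, pointwise convergence is uniform and a need only be
approximated on X.  Otherwise the points p n serve to separate the scales
1/(n+1). *)
Lemma property_gamma_frechet (y0 y1 : Y) : y1 <> y0 ->
  property_gamma XB -> frechet_urysohn Z.
Proof.
move=> y10 gammaX A a /closure_finite_ball clA.
have [/finite_seqP[s sT]|infX] := pselect (finite_set [set: X]).
  have /choice[u uP] n : exists h, A h /\
      forall x, d (ev a x) (ev h x) < n.+1%:R^-1.
    have n0 : 0 < n.+1%:R^-1 :> R by [].
    have [h Ah hs] := clA s _ n0; exists h; split=> // x; apply: hs.
    by have : [set: X] x by []; rewrite sT.
  exists u => [n|]; first by have [] := uP n.
  apply: cvg_pointwise => x e e0.
  apply: filterS (near_infty_natSinv_lt (PosNum e0)) => n /= ne.
  by apply: lt_trans ne; have [_] := uP n; exact.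
have [p pinj _] := infinite_set_sequence infX.
pose Uh n h : set XB := [set x | d (ev a x) (ev h x) < n.+1%:R^-1] `\ p n.
pose C := [set U : set XB | exists n h, A h /\ U = Uh n h].
have [| |U UC UT] := gammaX C.
- move=> _ [n [h [_ ->]]]; apply: openI.
    exact: (@open_locally_constant2 (fun y y' => d y y' < n.+1%:R^-1)
      _ _ (ev_locally_constant a) (ev_locally_constant h)).
  exact: baire_open_setC1 y10.
- move=> F fF; have [s sF] := (finite_seqP F).1 fF.
  have [n npF] : exists n, ~ F (p n).
    apply: contrapT => /forallNP pF; apply: infinite_nat.
    rewrite (_ : [set: nat] = p @^-1` F).
      by apply: finite_preimage => // i j _ _; exact: pinj.
    by apply/seteqP; split=> // n _; apply: contrapT; exact: pF.
  have n0 : 0 < n.+1%:R^-1 :> R by [].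
  have [h Ah hs] := clA s _ n0; exists (Uh n h); first by exists n, h.
  move=> x Fx; split; last by move=> /= xp; apply: npF; rewrite -xp.
  by apply: hs; move: Fx; rewrite sF.
have /choice[nh nhP] k : exists nh : nat * Z, A nh.2 /\ U k = Uh nh.1 nh.2.
  by have [n [h ?]] := UC k; exists (n, h).
exists (fun k => (nh k).2) => [k|]; first by have [] := nhP k.
have UE x : exists N, forall k, (N <= k)%N -> U k x.
  by have : [set: XB] x by []; rewrite -UT => -[N _ h]; exists N => k; exact: h.
(* U k misses p m whenever it comes from the m-th cover. *)
have nh_oo m : exists N, forall k, (N <= k)%N -> (m <= (nh k).1)%N.
  elim: m => [|m [N1 h1]]; first by exists 0%N.
  have [N2 h2] := UE (p m); exists (maxn N1 N2) => k.
  rewrite geq_max => /andP[/h1 + /h2].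
  have [_ ->] := nhP k; rewrite leq_eqVlt => /orP[/eqP -> [_ /(_ erefl)]|] //.
apply: cvg_pointwise => x e e0.
have [M _ Me] := near_infty_natSinv_lt (PosNum e0).
have [N1 h1] := nh_oo M; have [N2 h2] := UE x.
exists (maxn N1 N2) => // k /=; rewrite geq_max => /andP[/h1 Mk /h2].
have [_ ->] := nhP k => -[/= xk _]; apply: lt_trans xk _; exact: Me.
Qed.

(** * A k-space of functions has countable tightness *)

(** The compact sets of values taken by K at the points of F contain finitely
many terms of a sequence without cluster point. *)
Lemma compact_values_finite (K : set Z) (y : nat -> Y) (F : seq X) :
  compact K ->
  (forall p, exists2 e : R, 0 < e & finite_set [set n | d p (y n) < e]) ->
  exists N, forall n, (N <= n)%N -> forall h, K h ->
    forall x, x \in F -> ev h x <> y n.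
Proof.
move=> cK yP; elim: F => [|x F [N1 h1]]; first by exists 0%N.
suff [N2 h2] : exists N, forall n, (N <= n)%N -> forall h, K h -> ev h x <> y n.
  exists (maxn N1 N2) => n; rewrite geq_max => /andP[/h1 k1 /h2 k2] h Kh z.
  by rewrite in_cons => /orP[/eqP ->|]; [exact: k2|exact: k1].
pose S := [set n | exists2 h, K h & ev h x = y n].
have [/finite_seqP[s sS]|iS] := pselect (finite_set S).
  exists (\max_(i <- s) i).+1 => n nN h Kh hy.
  have : S n by exists h.
  by rewrite sS /= => ns; move: nN; rewrite ltnNge leq_bigmax_seq.
exfalso; have [_ [h0 _ _]] := infinite_setN0 iS.
have /choice[u uP] n : exists h, S n -> K h /\ ev h x = y n.
  by have [[h Kh hy]|] := pselect (S n); [exists h|exists h0].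
have [|g Kg gP] :=
    compact_cluster_family (u := u) cK (within_infinite_proper iS).
  by exists 0%N => // n _ /uP[].
have [e e0 /finite_seqP[s sE]] := yP (ev g x).
have [|n [Sn nN] /(_ x (mem_head _ _))] :=
  gP _ [set n | S n /\ (\max_(i <- s) i < n)%N] (nbhs_finite_ball g [:: x] e0).
  by exists (\max_(i <- s) i).+1.
have [_ ->] := uP n Sn => ge.
have : [set n | d (ev g x) (y n) < e] n by [].
by rewrite sE /= => ns; move: nN; rewrite ltnNge leq_bigmax_seq.
Qed.

(** If only finitely many F_i are contained in a neighbourhood of E, a function
equal to ystar on E and to y_n off this neighbourhood lies in A_n when n is
at least their number, so ystar is in the closure of the union of the A_n.  The
values y_n escape every compact set, which is where the non-compactness of Y
enters. *)
Lemma k_space_finite_trace (ystar : Y) (y : nat -> Y)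
    (I : Type) (S : set I) (F : I -> seq X) :
  (forall n, y n <> ystar) ->
  (forall p, exists2 e : R, 0 < e & finite_set [set n | d p (y n) < e]) ->
  k_space Z ->
  (forall E : seq X, exists U : set XB, [/\ open U, forall x, x \in E -> U x &
     finite_set [set i | S i /\ forall x, x \in F i -> U x]]) ->
  countable S.
Proof.
move=> ynE yP kZ trace; apply: contrapT => ncS.
(* Membership in A n is tested on families of n + 1 distinct indices, hence
   on finitely many points of X: this makes A n closed. *)
pose tr n h := [set i | S i /\ forall x, x \in F i -> ev h x <> y n].
pose A n := [set h | forall p : nat -> I, {in `I_n.+1 &, injective p} ->
  exists2 i, (i < n.+1)%N & ~ tr n h (p i)].
have cA n : closed (A n).
  move=> h /closure_finite_ball clh p pinj; apply: contrapT => np.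
  have {}np i : (i < n.+1)%N -> tr n h (p i).
    by move=> iN; apply: contrapT => ni; apply: np; exists i.
  pose E := flatten [seq F (p i) | i <- iota 0 n.+1].
  have [e e0 eE] : exists2 e : R, 0 < e &
      forall x, x \in E -> e <= d (ev h x) (y n).
    have : forall x, x \in E -> ev h x <> y n.
      move=> x /flattenP[s /mapP[i]]; rewrite mem_iota add0n => /= iN -> xF.
      by have [_] := np i iN; exact.
    elim: E => [|x E IH] hE; first by exists 1.
    have [|e e0 eE] := IH.
      by move=> z zE; apply: hE; rewrite in_cons zE orbT.
    exists (Num.min e (d (ev h x) (y n))).
      by rewrite lt_min e0 d_gt0//; apply: hE; rewrite mem_head.
    move=> z; rewrite in_cons => /orP[/eqP ->|/eE ez].
      by rewrite ge_min lexx orbT.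
    by rewrite ge_min ez.
  have [h' Ah' h'E] := clh E e e0.
  have [i iN] := Ah' p pinj; apply; have [Sp _] := np i iN; split=> // x xF h'x.
  have xE : x \in E.
    apply/flattenP; exists (F (p i)) => //; apply/mapP; exists i => //.
    by rewrite mem_iota add0n.
  by have := lt_le_trans (h'E x xE) (eE x xE); rewrite h'x ltxx.
have iS : infinite_set S by move=> /finite_set_countable.
have [a aE] := ev_cst ystar.
have ncA : ~ closed (\bigcup_n A n).
  move=> cU; have [n _ An] : (\bigcup_n A n) a.
    apply: cU; apply/closure_finite_ball => E e e0.
    have [U [oU EU /finite_setP[n Un]]] := trace E.
    have [f [sf fE fU]] := stable_baire1_separation (y n) ystar oU EU.
    have [h hf] := ev_stable sf; exists h; last first.
      by move=> x xE; rewrite hf fE // aE d0.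
    exists n => // p pinj; apply: contrapT => np.
    have : p @` `I_n.+1 `<=` [set i | S i /\ forall x, x \in F i -> U x].
      move=> _ [i iN <-]; have [Sp Fp] : tr n h (p i).
        by apply: contrapT => ni; apply: np; exists i.
      split=> // x xF; apply: contrapT => nUx; apply: (Fp x xF).
      by rewrite hf; exact: fU.
    move=> /subset_card_le; rewrite (card_le_eql (inj_card_eq pinj)).
    by rewrite (card_le_eqr Un) card_le_II ltnn.
  have [p pinj pS] := infinite_set_sequence iS.
  have [|i _] := An p; first by move=> i j _ _; exact: pinj.
  by apply; split=> // x _; rewrite aE => /esym; exact: ynE.
have [K cK KA] := k_space_closed_family kZ cA ncA.
have /choice[N NP] i := compact_values_finite (F i) cK yP.
have [M iM] : exists M, infinite_set [set i | S i /\ N i = M].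
  apply: contrapT => /forallNP nM; apply: ncS.
  have -> : S = \bigcup_M [set i | S i /\ N i = M].
    by apply/seteqP; split=> [i Si|i [? _ []]//]; exists (N i).
  apply: bigcup_countable => // M _; apply: finite_set_countable.
  exact: contrapT (nM M).
have [p pinj pS] := infinite_set_sequence iM.
have [n [h [Mn Anh Kh]]] := KA M.
have [|i _] := Anh p; first by move=> i j _ _; exact: pinj.
have [Sp NpM] := pS i; apply; split=> //.
by apply: (NP (p i) n) => //; rewrite NpM.
Qed.

(** An element p = (f, F, m) of the chain carries a function f, a finite set F
on which f agrees with b, and the scale 1/(m+1) at which the earlier
functions of the chain differ from b somewhere on F. *)
Lemma k_space_countable_tightness (ystar : Y) (y : nat -> Y) :
  (forall n, y n <> ystar) ->
  (forall p, exists2 e : R, 0 < e & finite_set [set n | d p (y n) < e]) ->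
  k_space Z -> countable_tightness Z.
Proof.
move=> ynE yP kZ A a clA; apply: contrapT => nB.
(* Since tightness fails at a, the union Ah of the closures of the countable
   subsets of A is closed under closures of countable sets, but not closed. *)
pose Ah := [set h | exists B, [/\ countable B, B `<=` A & closure B h]].
have AAh : A `<=` Ah.
  move=> h Ah0; exists [set h]; split; first exact: countable1.
    by move=> _ ->.
  exact: subset_closure.
have ncAh : ~ closed Ah.
  by move=> cAh; apply: nB; apply: cAh; exact: closureS clA.
have Ah_closure D h : countable D -> D `<=` Ah -> closure D h -> Ah h.
  move=> cD DA clD.
  have /choice[B BP] g :
      exists B, D g -> [/\ countable B, B `<=` A & closure B g].
    have [/DA[B BP]|nD] := pselect (D g); first by exists B.
    by exists set0.
  exists (\bigcup_(g in D) B g); split.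
  - by apply: bigcup_countable => // g /BP[].
  - by move=> z [g /BP[_ BA _]] /BA.
  - have /closure_id -> := @closed_closure _ (\bigcup_(g in D) B g).
    apply: closureS clD => g Dg; have [_ _] := BP g Dg.
    by apply: closureS => z Bz; exists g.
have [K cK ncK] := kZ _ ncAh.
have [b [Kb clb nb]] : exists b, [/\ K b, closure (Ah `&` K) b & ~ Ah b].
  apply: contrapT => nb; apply: ncK; apply/closed_subspaceP.
  exists (closure (Ah `&` K)); first exact: closed_closure.
  rewrite -setIA setIid; apply/seteqP; split=> z [clz Kz]; split=> //.
    by apply: contrapT => nz; apply: nb; exists z.
  by apply: subset_closure.
(* Upper bounds in the chain: b is far from any countable part of Ah ... *)
have sepb D : countable D -> D `<=` Ah -> exists (F : seq X) (m : nat),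
    forall f, D f -> exists2 x, x \in F & m.+1%:R^-1 <= d (ev b x) (ev f x).
  move=> cD DA.
  have /closure_finite_ball/existsNP[F /existsNP[e /not_implyP[e0 nF]]] :
    ~ closure D b by move/(Ah_closure D b cD DA).
  have [m _ /(_ m (leqnn m)) /= me] := near_infty_natSinv_lt (PosNum e0).
  exists F, m => f Df; apply: contrapT => nx; apply: nF; exists f => // x xF.
  by apply: lt_trans me; rewrite ltNge; apply/negP => xm; apply: nx; exists x.
(* ... and, by compactness of K, is matched exactly on any countable set of
   points by some function in both Ah and K. *)
have agree (C : set X) : countable C ->
    exists2 f, (Ah `&` K) f & forall x, C x -> ev f x = ev b x.
  move=> cC; have /closure_finite_ball clb' := clb.
  have [C0|nC0] := pselect (C !=set0); last first.
    have [f Af _] := clb' [::] 1 ltr01; exists f => // x Cx.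
    by exfalso; apply: nC0; exists x.
  have [u [_ Cu]] := countable_range cC C0.
  have /choice[f fP] n : exists f, (Ah `&` K) f /\
      forall i, (i <= n)%N -> d (ev b (u i)) (ev f (u i)) < n.+1%:R^-1.
    have n0 : 0 < n.+1%:R^-1 :> R by [].
    have [f Af fE] := clb' [seq u i | i <- iota 0 n.+1] _ n0.
    exists f; split=> // i i_n.
    by apply: fE; apply/mapP; exists i => //; rewrite mem_iota add0n.
  have [|g Kg gP] := compact_cluster_family (F := \oo) (u := f) cK _.
    by exists 0%N => // n _; have [[]] := fP n.
  exists g.
    split=> //; apply: (Ah_closure (range f)) => //.
    - by apply: sub_countable (card_image_le _ _) _.
    - by move=> _ [n _ <-]; have [[]] := fP n.
    - move=> V gV; have [n _ Vn] := gP V setT gV filterT.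
      by exists (f n); split=> //; exists n.
  move=> x /Cu[k <-]; apply/esym/d_squeeze => e e0.
  have e20 : 0 < e / 2 by rewrite divr_gt0.
  have [|n [/= ne kn] /(_ (u k) (mem_head _ _)) gn] :=
    gP _ [set n | n.+1%:R^-1 < e / 2 /\ (k <= n)%N]
      (nbhs_finite_ball g [:: u k] e20).
    apply: filterI; first exact: near_infty_natSinv_lt (PosNum e20).
    by exists k.
  have [_ /(_ k kn)] := fP n.
  have := dT (ev b (u k)) (ev (f n) (u k)) (ev g (u k)).
  rewrite (dC (ev (f n) (u k))); move: (n.+1%:R^-1) ne => c; lra.
pose V := [set p : Z * seq X * nat | (Ah `&` K) p.1.1 /\
  forall x, x \in p.1.2 -> ev p.1.1 x = ev b x].
pose lt (p q : Z * seq X * nat) :=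
  (forall x, x \in p.1.2 -> ev q.1.1 x = ev b x) /\
  exists2 x, x \in q.1.2 & q.2.+1%:R^-1 <= d (ev b x) (ev p.1.1 x).
have lt_irr q : V q -> ~ lt q q.
  move=> [_ qb] [_ [x /qb ->]]; rewrite d0; apply/negP; rewrite -ltNge //.
have lt_ext S : countable S -> S `<=` V ->
    exists2 q, V q & forall p, S p -> lt p q.
  move=> cS SV.
  have [||F [m sep]] := sepb [set p.1.1 | p in S].
  - exact: sub_countable (card_image_le _ _) cS.
  - by move=> _ [p /SV[[]] ? _ _ <-].
  have [|f Af fb] := agree ((\bigcup_(p in S) [set` p.1.2]) `|` [set` F]).
    rewrite -bigcup2E; apply: bigcup_countable => // -[|[|i]] _ //=.
      by apply: bigcup_countable => // p _; apply: finite_set_countable.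
    by apply: finite_set_countable.
  exists (f, F, m); first by split=> // x xF; apply: fb; right.
  move=> p Sp; split=> [x xp|]; first by apply: fb; left; exists p.
  by have [|x xF xm] := sep p.1.1; [exists p|exists x].
have [S0 [S0V ncS0 lin pre]] := uncountable_chain lt_irr lt_ext.
(* From here on a single scale 1/(m+1) is kept. *)
have [m ncS] : exists m, ~ countable [set p | S0 p /\ p.2 = m].
  apply: contrapT => /forallNP h; apply: ncS0.
  have -> : S0 = \bigcup_m [set p | S0 p /\ p.2 = m].
    by apply/seteqP; split=> [p Sp|p [? _ []]//]; exists p.2.
  by apply: bigcup_countable => // m _; exact: contrapT (h m).
set S := [set p | _] in ncS.
have PF := cocountable_proper ncS.
have [|g Kg gP] := compact_cluster_family (u := fun p => p.1.1) cK PF.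
  rewrite (_ : S `\` _ = set0) //; apply/seteqP; split=> // p.
  by move=> [[/S0V[[_ Kp] _] _] /(_ Kp)].
(* Functions above p in the chain agree with b on F_p, and all but countably
   many are above p. *)
have gb p x : S p -> x \in p.1.2 -> ev g x = ev b x.
  move=> [Sp _] xp; apply: d_squeeze => e e0.
  have [|q [qb _] /(_ x (mem_head _ _))] :=
      gP _ (lt p) (nbhs_finite_ball g [:: x] e0).
    apply: sub_countable (pre p Sp); apply: subset_card_le => q [[Sq _] npq].
    by split.
  by rewrite (qb x xp) => /ltW.
apply: ncS; apply: (k_space_finite_trace (F := fun p => p.1.2) ynE yP kZ) => E.
have m0 : 0 < m.+1%:R^-1 :> R by [].
have [|p Sp gp] := gP _ S (nbhs_finite_ball g E m0).
  by rewrite setDv.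
(* If U0 contains F_q, then f_p is close to b = g on F_q, so p is not below
   q. *)
pose U0 : set XB := [set x | d (ev g x) (ev p.1.1 x) < m.+1%:R^-1].
pose c := [set q | S q /\ forall x, x \in q.1.2 -> U0 x].
have cc : countable c.
  have [Sp0 _] := Sp; apply: sub_countable (pre p Sp0); apply: subset_card_le.
  move=> q [[Sq qm] qU]; split=> // -[_ [x xq]].
  rewrite qm leNgt => /negP; apply.
  by rewrite -(gb q x (conj Sq qm) xq); exact: qU.
have oU0 : open U0.
  exact: (@open_locally_constant2 (fun y y' => d y y' < m.+1%:R^-1)
    _ _ (ev_locally_constant g) (ev_locally_constant p.1.1)).
have fE : finite_set [set q | S q /\ forall x, x \in q.1.2 -> x \in E].
  set D := [set q | _].
  (* Elements of the chain with the same trace on E coincide: if lt q q', some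
     point of F_q' in E lies outside F_q. *)
  pose phi (q : Z * seq X * nat) : (size E).-tuple bool :=
    [tuple of map (mem q.1.2) (in_tuple E)].
  have phiD q q' x : phi q = phi q' -> x \in E ->
      (x \in q.1.2) = (x \in q'.1.2).
    by move=> /(congr1 val) /= /eq_in_map; exact.
  have phi_lt q q' : D q -> D q' -> phi q = phi q' -> ~ lt q q'.
    move=> [[Sq _] qE] [_ q'E] qq' [_ [x xq']].
    have xq : x \in q.1.2 by rewrite (phiD q q' x qq' (q'E x xq')).
    have [_ ->//] := S0V q Sq; rewrite d0; apply/negP; rewrite -ltNge //.
  have phi_inj : {in D &, injective phi}.
    move=> q q' /set_mem Dq /set_mem Dq' qq'; apply: contrapT => nqq'.
    have [[[Sq _] _] [[Sq' _] _]] := (Dq, Dq').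
    by case: (lin q q' Sq Sq' nqq'); exact: phi_lt.
  by rewrite -(eq_finite_set (inj_card_eq phi_inj)).
(* Removing one point of F_q outside E, for each of the countably many q. *)
have /choice[u uP] (q : Z * seq X * nat) : exists U : set XB,
    [/\ open U, forall x, x \in E -> U x &
      (forall x, x \in q.1.2 -> U x) -> forall x, x \in q.1.2 -> x \in E].
  have [qE|/existsNP[x /not_implyP[xq xE]]] :=
      pselect (forall x, x \in q.1.2 -> x \in E).
    by exists setT; split=> //; exact: openT.
  exists (~` [set x]); split.
  - exact: baire_open_setC1 (ynE 0%N).
  - by move=> z zE /= zx; apply: xE; rewrite -zx.
  - by move=> /(_ x xq) /(_ erefl).
have [[q0 cq0]|c0] := pselect (c !=set0); last first.
  exists U0; split=> //; rewrite (_ : [set _ | _] = set0) //.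
  by apply/seteqP; split=> // q cq; apply: c0; exists q.
have [v [_ cv]] := countable_range cc (ex_intro _ _ cq0).
exists (U0 `&` \bigcap_n u (v n)); split.
- apply: openI => //; apply: open_baire_bigcap => n.
  by have [] := uP (v n).
- by move=> x xE; split=> [|n _]; [exact: gp|have [_ + _] := uP (v n); exact].
- apply: sub_finite_set fE => q [Sq qU]; split=> //.
  have [n vn] : exists n, v n = q by apply: cv; split=> // x /qU[].
  have [_ _] := uP (v n); rewrite vn; apply => x /qU[_ /(_ n I)].
  by rewrite vn.
Qed.

End FunctionSpace.
End Tychonoff.
End MetrizableTarget.

Theorem theorem5p20 (R : realType) (X Y : topologicalType)
    (H : set {ptws X -> Y})
    (Ymetrizable : metrizable R Y)
    (Ynoncompact : ~ compact [set: Y])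
    (XYtychonoff : Y_tychonoff X Y)
    (HsubB : H `<=` baire_functions X Y)
    (B1stsubH : stable_baire1 X Y `<=` H) :
  [<-> frechet_urysohn (set_type H);
       sequential (set_type H);
       k_space (set_type H);
       countable_tightness (set_type H);
       property_gamma (baire_space R X)].
Proof.
have [d md nbhsY] := Ymetrizable.
have [ystar [y [ynE yP]]] := noncompact_sequence md nbhsY Ynoncompact.
pose ev (h : set_type H) : X -> Y := \val h.
have nbhsH (a : set_type H) P : nbhs a P <->
    exists (F : seq X) (e : R), 0 < e /\
    [set h | forall x, x \in F -> d (ev a x) (ev h x) < e] `<=` P.
  exact: nbhs_set_ptws.
have evL h : baire_locally_constant R (ev h).
  have [r _ [a fa]] := HsubB _ (set_valP h).
  exact: (baire_class_locally_constant md nbhsY fa).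
have evS f : stable_baire1 X Y f -> exists h, ev h = f.
  by move=> /B1stsubH Hf; exists (SigSub (mem_set Hf)).
tfae.
- exact: frechet_urysohn_sequential.
- exact: sequential_k_space.
- exact: (k_space_countable_tightness md nbhsY XYtychonoff
           nbhsH evL evS ynE yP).
- exact: (tightness_property_gamma md nbhsY XYtychonoff
           nbhsH evL evS (ynE 0%N)).
- exact: (property_gamma_frechet md nbhsY XYtychonoff nbhsH evL (ynE 0%N)).
Qed.
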